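(* Let $n\in\mathbb N$ (a positive integer). Then $c(n)$ is odd if and only if $n$ is eight times a generalized pentagonal number.
   Context: A partition of $n$ is a finite non-increasing sequence of positive integers (parts) with sum $n$. $\mathcal A_\nu(n)$ is the set of partitions of $n$ whose even parts are distinct and such that, if $m$ occurs as a part, then so does every positive even number less than $m$. For a partition $\pi$, $\ell_o(\pi)$ is the number of odd parts of $\pi$, counted with multiplicity. The integers $c(n)$ are given by $$c(n)=\sum_{\pi\in\mathcal A_\nu(n)}(\ell_o(\pi)-1),$$ equivalently $$\sum_{n\ge0}c(n)q^n=\sum_{k=0}^\infty\frac{q^{k^2+k}}{(q;q^2)_{k+1}}\left(\left(\sum_{j=0}^k\frac{q^{2j+1}}{1-q^{2j+1}}\right)-1\right),\qquad (q;q^2)_{k+1}=\prod_{j=0}^{k}(1-q^{2j+1}).$$ A generalized pentagonal number is an integer of the form $i(3i-1)/2$ with $i\in\mathbb Z$. *)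

(* Defs.v *)
From mathcomp Require Import all_boot all_order all_algebra.

Set Implicit Arguments.
Unset Strict Implicit.
Unset Printing Implicit Defensive.

Import GRing.Theory.

Definition is_partition (n : nat) (s : seq nat) : bool :=
  [&& sorted geq s, all (ltn 0) s & sumn s == n].

Definition even_parts_distinct (s : seq nat) : bool :=
  uniq [seq m <- s | ~~ odd m].

Definition smaller_evens_occur (s : seq nat) : bool :=
  all (fun m => [forall e : 'I_m, (0 < e) && ~~ odd e ==> (val e \in s)]) s.

(* A partition of n has at most n parts, each at most n, so the finite type of
   sequences of length at most n over {0, ..., n} contains every partition of n
   exactly once; see is_partition_bseq. *)
Definition parts (n : nat) (p : n.-bseq 'I_n.+1) : seq nat := map val p.

Definition A_nu (n : nat) : {set n.-bseq 'I_n.+1} :=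
  [set p : n.-bseq 'I_n.+1 | [&& is_partition n (parts p),
     even_parts_distinct (parts p) & smaller_evens_occur (parts p)]].

Definition ell_o (s : seq nat) : nat := count odd s.

(* The sum is taken in int: a partition without odd parts contributes -1. *)
Definition c (n : nat) : int :=
  (\sum_(p in A_nu n) ((ell_o (parts p))%:Z - 1))%R.

(* i * (3 i - 1) is always even, so the integer division is exact. *)
Definition gen_pentagonal (m : int) : Prop :=
  exists i : int, m = ((i * (3 * i - 1))%R %/ 2)%Z.

Definition oddz (m : int) : bool := ~~ (2 %| m)%Z.

Lemma parts_inj (n : nat) : injective (@parts n).
Proof. by move=> p q /(inj_map val_inj) /val_inj. Qed.

Lemma is_partition_bseq (n : nat) (s : seq nat) :
  is_partition n s -> exists p : n.-bseq 'I_n.+1, parts p = s.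
Proof.
case/and3P=> _ s_gt0 /eqP sum_s.
have size_le : size s <= n.
  rewrite -sum_s; elim: s s_gt0 {sum_s} => //= m s IHs /andP[m_gt0 /IHs le_s].
  by rewrite -add1n leq_add.
have le_n m : m \in s -> m < n.+1.
  rewrite ltnS -sum_s => m_s; elim: s m_s {s_gt0 sum_s size_le} => //= k s IHs.
  rewrite inE => /predU1P[-> | /IHs le_m]; first exact: leq_addr.
  exact: leq_trans le_m (leq_addl _ _).
have size_t : size (map (@inord n) s) <= n by rewrite size_map.
exists (Bseq size_t); rewrite /parts /= -map_comp -[RHS]map_id.
by apply/eq_in_map => m /le_n m_lt /=; rewrite inordK.
Qed.

(* Main.v *)
Require Import Defs.
From mathcomp Require Import all_boot all_order all_algebra.
From mathcomp Require Import zify ring.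

(** Write (a; b)_k for the product of the factors 1 - a b^j with j < k, and (a; b)
    for the infinite product.

    The number of odd parts of a partition of n has the parity of n, so
    c(n) = (n - 1) p(n) modulo 2, where p(n) counts the partitions in the class
    (oddz_c). Thus c(n) is even for odd n, and for even n the claim concerns
    p(n) modulo 2, a coefficient of the even part E(q^2) of
    nu(-q) = sum_k q^(k^2+k) / (q; q^2)_(k+1), the generating function of p
    (coef_nu_series).

    The even part is a product. An elementary recurrence gives
    (q^2; q^4) (nu(-q) + nu(q)) = 2 sum_(n >= 0) q^(n^2+n)
    (nu_series_add_opp), that is (Q; Q^2) E(Q) = psi(Q) with psi Gauss's series
    of triangular powers. Since psi(Q) = (Q^2; Q^2) / (Q; Q^2) (gauss_limit), the
    even part satisfies (Q; Q^2)^2 E(Q) = (Q^2; Q^2), which modulo 2 collapses to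
    E(Q) = (Q^4; Q^4). Euler's pentagonal number theorem (pentagonal_limit)
    expands this product: for even n, p(n) is odd exactly when n is eight times a
    generalized pentagonal number.

    Power series are handled through rings in which q is nilpotent: if q^N = 0,
    infinite sums and products are finite ones, 1 - q^i has a geometric sum as
    its inverse when i > 0, and every limit of a sequence of finite identities is
    attained at a finite stage. Applied to the class of X in the polynomials
    modulo X^N, this gives identities between the coefficients below N. *)

Set Implicit Arguments.
Unset Strict Implicit.
Unset Printing Implicit Defensive.
Import GRing.Theory Num.Theory.
Local Open Scope ring_scope.

(** * Finite sums in a nilpotent variable *)

Definition geom (R : comNzRingType) (N : nat) (x : R) : R := \sum_(i < N) x ^+ i.

(** The series of the quotients q^(k^2+k) / (q; q^2)_(k+1), that is nu(-q) for
    the third-order mock theta function nu, written for a q with q^N = 0. *)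
Definition nu_series (R : comNzRingType) (N : nat) (q : R) : R :=
  \sum_(k < N) q ^+ (k * k.+1) * \prod_(j < k.+1) geom N (q ^+ j.*2.+1).

Lemma expr_eq0_le (R : comNzRingType) (q : R) N m :
  q ^+ N = 0 -> (N <= m)%N -> q ^+ m = 0.
Proof. by move=> qN /subnKC <-; rewrite exprD qN mul0r. Qed.

Lemma geomK (R : comNzRingType) (x : R) N : x ^+ N = 0 -> (1 - x) * geom N x = 1.
Proof.
move=> xN; have := subrX1 x N; rewrite xN sub0r => /(congr1 -%R).
by rewrite opprK -mulNr opprB => <-.
Qed.

Lemma expr_mulA (R : comNzRingType) (q x : R) a b :
  q ^+ a * (q ^+ b * x) = q ^+ (a + b) * x.
Proof. by rewrite mulrA -exprD. Qed.

(** * The even part of the series as a theta quotient *)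

Section Bilateral.

Variables (R : comNzRingType) (q : R) (w : nat -> R).
Hypothesis wK : forall j, (1 - q ^+ j.*2.+1) * w j = 1.

Let h m := \prod_(j < m) w j.

Lemma h_diff m : h m.+1 - h m = q ^+ m.*2.+1 * h m.+1.
Proof.
have -> : h m.+1 = h m * w m by rewrite /h big_ord_recr.
by rewrite -[X in _ - X](mulr1 (h m)) -[X in _ - _ * X](wK m); ring.
Qed.

Variables (N K : nat).
Hypothesis qN : q ^+ N = 0.
Hypothesis NK : (N <= K * K.+1)%N.

(** Here h m is 1 / (q; q^2)_m. Let V_M be the sum of q^(n^2+n) h(n+M+1) over all
    integers n >= -M. Then V_0 is nu(-q), and
    V_(M+1) = (1 + q^(2M+1)) V_M + q^(M^2+M), because
    h(m+1) - h(m) = q^(2m+1) h(m+1) and n^2+n + 2(n+M+1)+1 is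
    (n+1)^2+(n+1) + 2M+1. As M grows, V_M tends to a full theta series divided
    by (q; q^2), while the recurrence unrolls into (-q; q^2) times
    nu(-q) + nu(q): a special case of Ramanujan's 1-psi-1 summation. This is the
    part n >= 0 of V_M; its terms with n >= K vanish, as q^(K(K+1)) = 0. *)
Definition nonneg_half M := \sum_(n < K) q ^+ (n * n.+1) * h (n + M).+1.

(** The part n < 0 of V_M, with n = -(m+1). *)
Definition neg_half M := \sum_(m < M) q ^+ (m * m.+1) * h (M - m).

(** Shifting n by one loses the term n = 0, whence the subtracted h(M+1), which
    the other half gives back. *)
Lemma nonneg_half_rec M :
  nonneg_half M.+1 = (1 + q ^+ M.*2.+1) * nonneg_half M - q ^+ M.*2.+1 * h M.+1.
Proof.
(* K = 0 would force N = 0, hence 1 = q^0 = 0. *)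
have [K' defK] : exists K', K = K'.+1.
  by case: K NK => [|K']; [rewrite leqn0 => /eqP N0; have := oner_eq0 R;
     rewrite -(expr0 q) -N0 qN eqxx | exists K'].
have step n : q ^+ (n * n.+1) * h (n + M.+1).+1 =
    q ^+ (n * n.+1) * h (n + M).+1 + q ^+ M.*2.+1 *
      (q ^+ (n.+1 * n.+2) * h (n.+1 + M).+1).
  rewrite addnS addSn; have /(canRL (subrK _)) {1}-> := h_diff (n + M).+1.
  rewrite mulrDr addrC; congr (_ + _).
  by rewrite !expr_mulA; congr (q ^+ _ * _); lia.
rewrite {1}/nonneg_half; under eq_bigr do rewrite step; rewrite big_split /= -mulr_sumr.
have -> : \sum_(n < K) q ^+ (n.+1 * n.+2) * h (n.+1 + M).+1 =
    nonneg_half M - h M.+1.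
  rewrite /nonneg_half defK big_ord_recr /= [in RHS]big_ord_recl /=.
  rewrite -defK (expr_eq0_le qN) ?mul0r ?addr0; last by nia.
  by rewrite mul0n expr0 mul1r add0n addrC addKr.
rewrite /nonneg_half; ring.
Qed.

Lemma neg_half_rec M :
  neg_half M.+1 = (1 + q ^+ M.*2.+1) * neg_half M + q ^+ M.*2.+1 * h M.+1
                  + q ^+ (M * M.+1).
Proof.
have h1 : h 1 = w 0 by rewrite /h big_ord1.
have w0 : w 0 = 1 + q * w 0 by rewrite -[in RHS](wK 0) expr1; ring.
case: M => [|M].
  rewrite /neg_half big_ord1 big_ord0 mulr0 add0r subn0 h1 !mul0n expr0 mul1r.
  by rewrite expr1 addrC.
have step n : (n < M)%N -> q ^+ (n.+1 * n.+2) * h (M.+2 - n.+1) =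
    q ^+ (n.+1 * n.+2) * h (M.+1 - n.+1)
    + q ^+ (M.+1).*2.+1 * (q ^+ (n * n.+1) * h (M.+1 - n)).
  move=> ltnM; have -> : (M.+2 - n.+1 = (M - n).+1)%N by lia.
  have -> : (M.+1 - n.+1 = M - n)%N by lia.
  have -> : (M.+1 - n = (M - n).+1)%N by lia.
  have /(canRL (subrK _)) {1}-> := h_diff (M - n).
  rewrite mulrDr addrC; congr (_ + _).
  by rewrite !expr_mulA; congr (q ^+ _ * _); nia.
pose S1 := \sum_(n < M) q ^+ (n.+1 * n.+2) * h (M.+1 - n.+1).
pose S2 := \sum_(n < M) q ^+ (n * n.+1) * h (M.+1 - n).
have splitl : neg_half M.+1 = h M.+1 + S1.
  by rewrite /neg_half big_ord_recl mul0n expr0 mul1r subn0.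
have splitr : neg_half M.+1 = S2 + q ^+ (M * M.+1) * w 0.
  by rewrite /neg_half big_ord_recr /= subSnn h1.
have -> : neg_half M.+2 =
    h M.+2 + (S1 + q ^+ (M.+1).*2.+1 * S2) + q ^+ (M.+1 * M.+2) * w 0.
  rewrite /neg_half big_ord_recr big_ord_recl mul0n expr0 mul1r subn0 subSnn h1.
  congr (_ + _ + _); rewrite /S2 mulr_sumr -big_split /=.
  by apply: eq_bigr => n _; rewrite step.
have /(canRL (subrK _)) {1}-> := h_diff M.+1.
rewrite mulrDl mul1r {1}splitl splitr.
(* Both sides are now combinations of h(M+2), h(M+1), S1, S2 and w 0 = h(1), to
   be compared through w 0 = 1 + q (w 0). *)
have e1 : q ^+ (M.+1 * M.+2) = q ^+ (M.+1).*2 * q ^+ (M * M.+1).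
  by rewrite -exprD; congr (q ^+ _); lia.
have e2 : q ^+ (M.+1).*2.+1 = q * q ^+ (M.+1).*2 by rewrite exprS.
rewrite e1 e2 {1}w0; ring.
Qed.

(** The recurrence for V_M, unrolled. *)
Lemma bilateral_finite M :
  nonneg_half M + neg_half M =
  (\prod_(i < M) (1 + q ^+ i.*2.+1)) * nonneg_half 0
  + \sum_(n < M) q ^+ (n * n.+1) * \prod_(n.+1 <= i < M) (1 + q ^+ i.*2.+1).
Proof.
elim: M => [|M IHM]; first by rewrite /neg_half !big_ord0 mul1r.
rewrite nonneg_half_rec neg_half_rec [X in _ = X * _ + _]big_ord_recr /=.
rewrite [X in _ = _ + X]big_ord_recr /= big_geq // mulr1.
have -> : \sum_(n < M) q ^+ (n * n.+1) *
      \prod_(n.+1 <= i < M.+1) (1 + q ^+ i.*2.+1) =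
    (1 + q ^+ M.*2.+1) * \sum_(n < M) q ^+ (n * n.+1) *
      \prod_(n.+1 <= i < M) (1 + q ^+ i.*2.+1).
  rewrite mulr_sumr; apply: eq_bigr => n _.
  by rewrite big_nat_recr //= mulrA [LHS]mulrC.
rewrite [\prod_(i < M) _ * (1 + _)]mulrC -mulrA.
by move: IHM; set S := \sum_(n < M) _ => /esym /(canRL (addrK S)) ->; ring.
Qed.

End Bilateral.

Lemma prod_mul_inv (R : comNzRingType) (u w : nat -> R) M :
  (forall j, u j * w j = 1) -> (\prod_(j < M) u j) * \prod_(j < M) w j = 1.
Proof. by move=> uw; rewrite -big_split /= big1. Qed.

(** The factors w j with a + 2j + 1 >= N act as 1 on q^a: this replaces the
    passage to an infinite product. *)
Lemma prod_tail_absorb (R : comNzRingType) (q : R) (w : nat -> R) N a b c :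
    (forall j, (1 - q ^+ j.*2.+1) * w j = 1) -> q ^+ N = 0 ->
    (b <= c)%N -> (N <= a + b.*2.+1)%N ->
  q ^+ a * \prod_(j < c) w j = q ^+ a * \prod_(j < b) w j.
Proof.
move=> wK qN /subnKC <- Nab; elim: (c - b)%N => [|d IHd]; first by rewrite addn0.
rewrite addnS big_ord_recr /= mulrA IHd mulrAC; congr (_ * _).
rewrite -[in RHS](mulr1 (q ^+ a)) -(wK (b + d)%N) mulrBl mul1r mulrBr expr_mulA.
by rewrite [q ^+ (a + _)](expr_eq0_le qN) ?mul0r ?subr0 //; lia.
Qed.

(** The finite identity at M = N. There every h in V_N can be replaced by h N,
    so each half of V_N becomes h N times the same theta sum: n and -1-n
    give the same exponent n^2+n. *)
Lemma bilateral_limit (R : comNzRingType) (q : R) (w w' : nat -> R) N :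
    q ^+ N = 0 ->
    (forall j, (1 - q ^+ j.*2.+1) * w j = 1) ->
    (forall j, (1 + q ^+ j.*2.+1) * w' j = 1) ->
  (\prod_(i < N) (1 - (q ^+ i.*2.+1) ^+ 2)) *
    (\sum_(k < N) q ^+ (k * k.+1) * \prod_(j < k.+1) w j +
     \sum_(k < N) q ^+ (k * k.+1) * \prod_(j < k.+1) w' j) =
  (\sum_(n < N) q ^+ (n * n.+1)) *+ 2.
Proof.
move=> qN wK w'K.
have NN : (N <= N * N.+1)%N by nia.
have := bilateral_finite wK qN NN N; rewrite /nonneg_half /neg_half.
under eq_bigr => n _.
  rewrite (@prod_tail_absorb _ q w N _ N _ wK) //; [over | by lia | by lia].
under [X in _ + X = _]eq_bigr => m _.
  rewrite -(@prod_tail_absorb _ q w N _ _ N wK qN); [over | by lia | by nia].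
under [X in _ = _ + X]eq_bigr => n _.
  have -> : \prod_(n.+1 <= i < N) (1 + q ^+ i.*2.+1) =
      (\prod_(i < N) (1 + q ^+ i.*2.+1)) * \prod_(j < n.+1) w' j.
    rewrite -[\prod_(i < N) _](big_mkord xpredT (fun i => 1 + q ^+ i.*2.+1)).
    rewrite (big_cat_nat (leq0n _) (ltn_ord n)) /= big_mkord mulrAC.
    by rewrite (prod_mul_inv _ w'K) mul1r.
  rewrite mulrCA; over.
rewrite -!mulr_suml -mulr_sumr.
under [X in _ = _ * X + _]eq_bigr do rewrite addn0.
set S := \sum_(n < N) _; set F := \sum_(k < N) _ * _; set F' := \sum_(k < N) _ * _.
have sqrE x : 1 - x ^+ 2 = (1 - x) * (1 + x) :> R by ring.
move=> E; under eq_bigr do rewrite sqrE.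
rewrite big_split /= -mulrA mulrDr -E -mulrDl mulrC -mulrA.
by rewrite [\prod_(j < N) w j * _]mulrC (prod_mul_inv _ wK) mulr1 mulr2n.
Qed.

Lemma nu_series_add_opp (R : comNzRingType) (q : R) N : q ^+ N = 0 ->
  (\prod_(i < N) (1 - (q ^+ i.*2.+1) ^+ 2)) *
    (nu_series N q + nu_series N (- q)) = (\sum_(n < N) q ^+ (n * n.+1)) *+ 2.
Proof.
move=> qN; rewrite /nu_series.
have signE k : (- q) ^+ (k * k.+1) = q ^+ (k * k.+1).
  by rewrite exprNn -signr_odd oddM /= andbN mul1r.
have geomE j : (1 + q ^+ j.*2.+1) * geom N ((- q) ^+ j.*2.+1) = 1.
  have -> : 1 + q ^+ j.*2.+1 = 1 - (- q) ^+ j.*2.+1.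
    by rewrite [(- q) ^+ _]exprNn -signr_odd /= odd_double mulN1r opprK.
  by apply: geomK; rewrite exprAC exprNn qN mulr0 expr0n.
under [X in _ * (_ + X)]eq_bigr do rewrite signE.
apply: (bilateral_limit (w := fun j => geom N (q ^+ j.*2.+1))
  (w' := fun j => geom N ((- q) ^+ j.*2.+1))) => // j.
by apply: geomK; rewrite exprAC qN expr0n.
Qed.

Lemma bin2S s : 'C(s.+2, 2) = ('C(s.+1, 2) + s.+1)%N.
Proof. by rewrite binS bin1. Qed.

(** * Gauss's triangular number series *)

Section FiniteGauss.

Variables (R : comNzRingType) (q : R) (w : nat -> R).
Hypothesis wK : forall j, (1 - q ^+ j.*2.+1) * w j = 1.

Let ratio s n := \prod_(s <= i < n) ((1 - q ^+ i.*2.+2) * w i).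

(** Shanks's finite form of Gauss's identity. The increment in n of the summand
    is a difference G(s+1) - G(s), so that passing from n to n+1 adds only the
    boundary term and the new summand, which together are the two new
    triangular powers. *)
Lemma gauss_finite n :
  \sum_(s < n) q ^+ (s * n.*2.+1) * ratio s n =
  \sum_(j < n.*2) q ^+ 'C(j.+1, 2).
Proof.
elim: n => [|n IHn]; first by rewrite !big_ord0.
rewrite doubleS !big_ord_recr /= -IHn -addrA.
pose G s := q ^+ (s * n.*2.+1) * (1 - q ^+ s.*2) * w n * ratio s n.
have step s : (s < n)%N ->
    q ^+ (s * n.+1.*2.+1) * ratio s n.+1 =
    q ^+ (s * n.*2.+1) * ratio s n + (G s.+1 - G s).
  move=> ltsn; rewrite /G {1}/ratio big_nat_recr 1?ltnW //= -/(ratio s n).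
  have ratioS : (1 - q ^+ s.*2.+2) * ratio s.+1 n = (1 - q ^+ s.*2.+1) * ratio s n.
    rewrite [ratio s n]big_ltn // -/(ratio s.+1 n) -[LHS]mul1r.
    by rewrite -[X in X * _ = _](wK s); ring.
  rewrite doubleS -[X in _ = _ + (X - _)]mulrA mulrACA ratioS.
  have -> : (s * n.*2.+3 = s * n.*2.+1 + s.*2)%N by lia.
  have -> : (s.+1 * n.*2.+1 = s * n.*2.+1 + n.*2.+1)%N by lia.
  rewrite -[X in _ = X + _]mul1r -[X in X * _ + _](wK n).
  rewrite [q ^+ n.*2.+2]exprS [q ^+ s.*2.+1]exprS !exprD; ring.
have Gn : \sum_(s < n) (G s.+1 - G s) = G n.
  rewrite -(big_mkord xpredT (fun s => G s.+1 - G s)) telescope_sumr //.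
  by rewrite /G expr0 subrr mulr0 !mul0r subr0.
rewrite (eq_bigr _ (fun s _ => step _ (ltn_ord s))) big_split /= Gn -addrA.
congr (_ + _); rewrite /G /ratio big_geq // big_nat1 mulr1.
have -> : (n * n.+1.*2.+1 = n * n.*2.+1 + n.*2)%N by lia.
have binE : 'C(n.*2.+1, 2) = (n * n.*2.+1)%N.
  by rewrite bin2 /= -doubleMr doubleK mulnC.
rewrite bin2S binE !exprD -[X in _ = X + _]mulr1 -[X in _ = _ * X + _](wK n).
have := wK n; rewrite [q ^+ n.*2.+1]exprS [q ^+ n.*2.+2]exprS exprS.
set e := q ^+ (_ * _); set a := q ^+ n.*2 => wa.
have -> : e * (q * a) = e * (q * a) * ((1 - q * a) * w n) by rewrite wa mulr1.
ring.
Qed.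

End FiniteGauss.

(** Only the term s = 0 of the finite form survives when q^N = 0 and n = N. *)
Lemma gauss_limit (R : comNzRingType) (q : R) (w : nat -> R) N :
    q ^+ N = 0 -> (forall j, (1 - q ^+ j.*2.+1) * w j = 1) ->
  (\prod_(i < N) (1 - q ^+ i.*2.+1)) * (\sum_(j < N.*2) q ^+ 'C(j.+1, 2)) =
  \prod_(i < N) (1 - q ^+ i.*2.+2).
Proof.
case: N => [q0|N qN wK].
  by have := oner_eq0 R; rewrite -(expr0 q) q0 eqxx.
rewrite -(gauss_finite wK) [X in _ * X]big_ord_recl /= mul0n expr0 mul1r.
rewrite [X in _ * (_ + X)]big1 => [|s _].
  rewrite addr0 big_mkord big_split /= mulrCA (prod_mul_inv _ wK) mulr1 //.
by rewrite (expr_eq0_le qN) ?mul0r // /bump /= add1n; nia.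
Qed.

(** * Euler's pentagonal number series *)

Section FinitePentagonal.

Variables (R : comNzRingType) (q : R).

Let ratio s n := \prod_(s <= i < n) (1 - q ^+ i.+1).

(** With s = t+1, the exponents s^2 + 'C(s, 2) and s^2 + 'C(s+1, 2) are the
    generalized pentagonal numbers s(3s-1)/2 and s(3s+1)/2. *)
Definition pentagonal_sum n :=
  1 + \sum_(t < n) (-1) ^+ t.+1 *
        (q ^+ (t.+1 ^ 2 + 'C(t.+1, 2)) + q ^+ (t.+1 ^ 2 + 'C(t.+2, 2))).

(** Shanks's finite form of the pentagonal number theorem, telescoping in s like
    that of Gauss's identity. *)
Lemma pentagonal_finite n :
  \sum_(s < n.+1) (-1) ^+ s * q ^+ (s * n + 'C(s.+1, 2)) * ratio s n =
  pentagonal_sum n.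
Proof.
rewrite /pentagonal_sum; elim: n => [|n IHn].
  by rewrite big_ord1 big_ord0 /ratio big_geq // !expr0 !mulr1 addr0.
rewrite [in RHS]big_ord_recr addrA -IHn [LHS]big_ord_recr /=.
(* For 0 < s <= n, K s is the summand times 1 - q^s; writing that factor into the
   ratio makes the same formula give the boundary term K n.+1. *)
pose K s := if s is t.+1 then
  (-1) ^+ s * q ^+ (s * n + 'C(s.+1, 2)) * ratio t n else 0.
have step s : (s < n.+1)%N ->
    (-1) ^+ s * q ^+ (s * n.+1 + 'C(s.+1, 2)) * ratio s n.+1 =
    (-1) ^+ s * q ^+ (s * n + 'C(s.+1, 2)) * ratio s n + (K s.+1 - K s).
  rewrite ltnS => lesn; rewrite {1}/ratio big_nat_recr //= -/(ratio s n).
  have -> : K s = (-1) ^+ s * q ^+ (s * n + 'C(s.+1, 2)) *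
      ((1 - q ^+ s) * ratio s n).
    case: s lesn => [|s] lesn; first by rewrite subrr mul0r mulr0.
    by rewrite /K; congr (_ * _); rewrite {1}/ratio big_ltn.
  rewrite /K bin2S.
  have -> : (s * n.+1 + 'C(s.+1, 2) = s * n + 'C(s.+1, 2) + s)%N by lia.
  have -> : (s.+1 * n + ('C(s.+1, 2) + s.+1) =
    s * n + 'C(s.+1, 2) + s + n.+1)%N by lia.
  move: (s * n + _)%N => e; rewrite (exprD _ (e + s)) (exprD _ e s) !exprS.
  ring.
have Kn : \sum_(s < n.+1) (K s.+1 - K s) = K n.+1.
  by rewrite -(big_mkord xpredT (fun s => K s.+1 - K s)) telescope_sumr // subr0.
rewrite (eq_bigr _ (fun s _ => step _ (ltn_ord s))) big_split /= Kn -addrA.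
congr (_ + _); rewrite /K /ratio !big_geq // !mulr1 mulrDr.
congr (_ * q ^+ _ + _ * q ^+ _); rewrite ?bin2S; lia.
Qed.

Lemma pentagonal_limit N : q ^+ N = 0 ->
  \prod_(i < N) (1 - q ^+ i.+1) = pentagonal_sum N.
Proof.
move=> qN; rewrite -pentagonal_finite big_ord_recl /= mul0n !expr0 !mul1r.
rewrite /ratio big_mkord [X in _ + X]big1 ?addr0 // => s _.
rewrite (expr_eq0_le qN) ?mulr0 ?mul0r // /bump /= add1n; nia.
Qed.

End FinitePentagonal.

(** * Collapse in characteristic two *)

Lemma prod_even_odd (R : comNzRingType) (f : nat -> R) n :
  \prod_(i < n.*2) f i = (\prod_(i < n) f i.*2) * \prod_(i < n) f i.*2.+1.
Proof.
elim: n => [|n IHn]; first by rewrite !big_ord0 mulr1.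
by rewrite doubleS !big_ord_recr /= IHn -!mulrA; congr (_ * _); rewrite mulrCA.
Qed.

(** Put q = x^2. The hypothesis reads (q; q^2) e = psi(q), where psi is Gauss's
    series, so that (q; q^2)^2 e = (q^2; q^2). In characteristic two the square
    is (q^2; q^4), the odd-indexed half of (q^2; q^2); cancelling it leaves
    e = (q^4; q^4), which is Euler's product at x^8. *)
Lemma pentagonal_of_char2 (R : comNzRingType) (x e : R) N :
    x ^+ N = 0 -> 2%:R = 0 :> R ->
    (\prod_(i < N) (1 - (x ^+ i.*2.+1) ^+ 2)) * e = \sum_(n < N) x ^+ (n * n.+1) ->
  e = pentagonal_sum (x ^+ 8) N.
Proof.
move=> xN R2.
have powN k : (0 < k)%N -> (x ^+ k) ^+ N = 0.
  by move=> k0; rewrite exprAC xN expr0n -[k]prednK.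
have geomP (k : nat) (j : nat) : (0 < k)%N ->
    (1 - (x ^+ k) ^+ j.*2.+1) * geom N ((x ^+ k) ^+ j.*2.+1) = 1.
  by move=> k0; apply: geomK; rewrite exprAC powN // expr0n.
under eq_bigr do rewrite exprAC.
set D := \prod_(i < N) _ => De.
have gauss := gauss_limit (powN 2 isT) (fun j => geomP 2%N j isT).
have sumE : \sum_(j < N.*2) (x ^+ 2) ^+ 'C(j.+1, 2) = D * e.
  rewrite De -addnn big_split_ord /= [X in _ + X]big1 ?addr0 => [|j _].
    by apply: eq_bigr => j _; rewrite -exprM -mul_bin_diag bin1 mulnC.
  by rewrite -exprM -mul_bin_diag bin1 (expr_eq0_le xN) //=; nia.
have sqrB (y : R) : (1 - y) ^+ 2 = 1 - y ^+ 2.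
  have -> : (1 - y) ^+ 2 = 1 - y ^+ 2 + 2%:R * (y ^+ 2 - y) by ring.
  by rewrite R2 mul0r addr0.
have D2 : D * D = \prod_(i < N) (1 - (x ^+ 4) ^+ i.*2.+1).
  rewrite -big_split; apply: eq_bigr => i _ /=.
  by rewrite -expr2 sqrB -!exprM; congr (1 - x ^+ _); lia.
move: gauss; rewrite -/D sumE mulrA D2.
have -> : \prod_(i < N) (1 - (x ^+ 2) ^+ i.*2.+2) =
    (\prod_(i < N) (1 - (x ^+ 4) ^+ i.*2.+1)) * \prod_(i < N) (1 - (x ^+ 8) ^+ i.+1).
  under [X in _ = _ * X]eq_bigr => i _.
    have -> : (x ^+ 8) ^+ i.+1 = (x ^+ 4) ^+ i.*2.+2.
      by rewrite -!exprM; congr (x ^+ _); lia.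
    over.
  rewrite -(prod_even_odd (fun i => 1 - (x ^+ 4) ^+ i.+1)) -addnn big_split_ord /=.
  rewrite [X in _ = _ * X]big1 ?mulr1 => [|i _].
    by apply: eq_bigr => i _; rewrite -!exprM; congr (1 - x ^+ _); lia.
  by rewrite (expr_eq0_le (powN 4 isT)) ?subr0 //; lia.
have DK := prod_mul_inv N (fun j => geomP 4 j isT).
move=> /(congr1 ( *%R (\prod_(j < N) geom N ((x ^+ 4) ^+ j.*2.+1)))).
rewrite !mulrA [X in X * _]mulrC [X in _ = X * _]mulrC DK !mul1r => ->.
by rewrite pentagonal_limit ?powN.
Qed.

(** * Truncated polynomials *)

Section Truncation.

Variables (A : comNzRingType) (N : nat).
Hypothesis N_gt0 : (0 < N)%N.

Let trunc := in_qpoly ('X^N : {poly A}).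

Lemma truncXn : trunc 'X ^+ N = 0.
Proof.
rewrite -rmorphXn /=; apply/val_inj => /=.
by rewrite mk_monic_Xn prednK // Pdiv.RingMonic.rmodpp // monicXn.
Qed.

Lemma trunc_eqP (p r : {poly A}) :
  trunc p = trunc r <-> forall i, (i < N)%N -> p`_i = r`_i.
Proof.
have truncE s : trunc s = take_poly N s :> {poly A}.
  rewrite -[s in LHS](poly_take_drop N) /trunc in_qpolyD in_qpolyM.
  rewrite [in_qpoly _ 'X^N]rmorphXn truncXn.
  rewrite mulr0 addr0 in_qpoly_small // mk_monic_Xn prednK // size_polyXn ltnS.
  exact: size_take_poly.
split=> [eq_pr i ltiN | eq_pr].
  have := congr1 (fun s : {poly %/ 'X^N} => (s : {poly A})`_i) eq_pr.
  by rewrite !truncE !coef_take_poly ltiN.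
apply/val_inj; change (trunc p = trunc r :> {poly A}).
rewrite !truncE; apply/polyP=> i.
by rewrite !coef_take_poly; case: ifP => // /eq_pr.
Qed.

End Truncation.

Lemma rmorph_nu_series (R S : comNzRingType) (f : {rmorphism R -> S}) N q :
  f (nu_series N q) = nu_series N (f q).
Proof.
rewrite rmorph_sum; apply: eq_bigr => k _.
rewrite rmorphM rmorphXn rmorph_prod; congr (_ * _); apply: eq_bigr => j _.
by rewrite rmorph_sum; apply: eq_bigr => i _; rewrite !rmorphXn.
Qed.

Lemma rmorph_pentagonal_sum (R S : comNzRingType) (f : {rmorphism R -> S}) N q :
  f (pentagonal_sum q N) = pentagonal_sum (f q) N.
Proof.
rewrite rmorphD rmorph1 rmorph_sum; congr (_ + _); apply: eq_bigr => t _.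
by rewrite rmorphM rmorphD !rmorphXn rmorphN1.
Qed.

Lemma coef_comp_polyNX (R : comNzRingType) (p : {poly R}) i :
  (p \Po - 'X)`_i = (-1) ^+ i * p`_i.
Proof.
have -> : p \Po - 'X = \poly_(j < size p) ((-1) ^+ j * p`_j).
  rewrite comp_polyE poly_def; apply: eq_bigr => j _.
  rewrite [(- 'X) ^+ _]exprNn.
  have -> : (-1) ^+ j = ((-1) ^+ j)%:P :> {poly R} by rewrite rmorphXn rmorphN1.
  by rewrite -!mul_polyC polyCM mulrA [X in X * _]mulrC.
by rewrite coef_poly; case: ltnP => // /(nth_default 0) ->; rewrite mulr0.
Qed.

Lemma F2_2 : 2%:R = 0 :> 'F_2.
Proof. exact: val_inj. Qed.

(** The identity for nu(-q) + nu(q) is twice the one needed. The factor 2 has to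
    be cancelled over the integers, before the coefficients are reduced. *)
Lemma nu_coef_mod2 N n : (n < N)%N -> ~~ odd n ->
  ((nu_series N ('X : {poly int}))`_n)%:~R = (pentagonal_sum 'X^8 N)`_n :> 'F_2.
Proof.
move=> ltnN even_n; have N_gt0 : (0 < N)%N by case: N ltnN.
set P := nu_series N _.
(* Half of nu(-q) + nu(q): the even part of nu(-q). *)
pose E : {poly int} := \poly_(i < size P) (if odd i then 0 else P`_i).
have PE : P + nu_series N (- 'X) = E *+ 2.
  have -> : nu_series N (- 'X) = P \Po (- 'X).
    by rewrite /P (rmorph_nu_series (comp_poly (- 'X))) /= comp_polyX.
  apply/polyP=> i; rewrite coefD coefMn coef_comp_polyNX coef_poly.
  rewrite -signr_odd; case: ltnP => [_ | /(nth_default 0) ->].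
    by case: (odd i); rewrite ?mulN1r ?subrr ?mul0rn // mul1r.
  by rewrite mulr0 addr0 mul0rn.
pose D (R : comNzRingType) (q : R) := \prod_(i < N) (1 - (q ^+ i.*2.+1) ^+ 2).
pose S (R : comNzRingType) (q : R) := \sum_(n < N) q ^+ (n * n.+1).
have Dmorph (R R' : comNzRingType) (f : {rmorphism R -> R'}) q : f (D R q) = D R' (f q).
  by rewrite rmorph_prod; apply: eq_bigr => i _; rewrite rmorphB rmorph1 !rmorphXn.
have Smorph (R R' : comNzRingType) (f : {rmorphism R -> R'}) q : f (S R q) = S R' (f q).
  by rewrite rmorph_sum; apply: eq_bigr => i _; rewrite rmorphXn.
have DE i : (i < N)%N -> (D _ 'X * E)`_i = (S _ ('X : {poly int}))`_i.
  have /trunc_eqP eqDE : in_qpoly 'X^N (D _ 'X * (E *+ 2)) =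
      in_qpoly 'X^N (S _ ('X : {poly int}) *+ 2).
    rewrite rmorphM /= Dmorph -PE rmorphD /= /P !rmorph_nu_series rmorphN /=.
    by rewrite rmorphMn /= Smorph; apply: nu_series_add_opp (truncXn _ N_gt0).
  move=> ltiN; have := eqDE N_gt0 i ltiN.
  by rewrite mulrnAr !coefMn => /eqP; rewrite eqr_pMn2r // => /eqP.
have DE2 : in_qpoly 'X^N (D _ 'X * map_poly intr E : {poly 'F_2}) =
    in_qpoly 'X^N (S _ 'X : {poly 'F_2}).
  apply/trunc_eqP => // i ltiN.
  have := congr1 (intr : int -> 'F_2) (DE i ltiN).
  by rewrite -!coef_map rmorphM Dmorph Smorph /= map_polyX.
have x0 := @truncXn 'F_2 _ N_gt0.
have := pentagonal_of_char2 x0 _ (e := in_qpoly 'X^N (map_poly intr E : {poly 'F_2})).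
rewrite rmorphM Dmorph Smorph in DE2; move/(_ _ DE2).
rewrite -rmorphXn -(rmorph_pentagonal_sum (in_qpoly 'X^N)) => eqE.
have /trunc_eqP : in_qpoly 'X^N (map_poly intr E : {poly 'F_2}) =
    in_qpoly 'X^N (pentagonal_sum 'X^8 N).
  by apply: eqE; rewrite -(rmorph_nat (in_qpoly 'X^N)) -polyC_natr F2_2 rmorph0.
move=> /(_ N_gt0 n ltnN) <-; rewrite coef_map coef_poly /= (negbTE even_n).
by case: ltnP => // /(nth_default 0) ->.
Qed.

(** * Coefficients of the pentagonal series *)

Lemma F2_natr m : m%:R = (odd m)%:R :> 'F_2.
Proof.
by rewrite -[in LHS](odd_double_half m) natrD -muln2 natrM F2_2 mulr0 addr0.
Qed.

Lemma double_bin2 s : (2 * 'C(s.+1, 2) = s.+1 * s)%N.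
Proof. by rewrite -mul_bin_diag bin1. Qed.

(** The two families come from the indices i = t+1 and i = -(t+1). *)
Lemma gen_pentagonalP (m : nat) : (0 < m)%N ->
  gen_pentagonal m <->
  exists t, m = (t.+1 ^ 2 + 'C(t.+1, 2))%N \/ m = (t.+1 ^ 2 + 'C(t.+2, 2))%N.
Proof.
move=> m_gt0.
have posE t : ((t.+1%:Z * (3 * t.+1%:Z - 1)) %/ 2)%Z = (t.+1 ^ 2 + 'C(t.+1, 2))%N.
  have -> : t.+1%:Z * (3 * t.+1%:Z - 1) = (t.+1 ^ 2 + 'C(t.+1, 2))%N%:Z * 2.
    by have := double_bin2 t; nia.
  by rewrite mulzK.
have negE t : ((- t.+1%:Z * (3 * - t.+1%:Z - 1)) %/ 2)%Z = (t.+1 ^ 2 + 'C(t.+2, 2))%N.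
  have -> : - t.+1%:Z * (3 * - t.+1%:Z - 1) = (t.+1 ^ 2 + 'C(t.+2, 2))%N%:Z * 2.
    by have := double_bin2 t.+1; nia.
  by rewrite mulzK.
split=> [[[[|t]|t] /eqP] | [t [] ->]].
- by rewrite mul0r div0z; lia.
- by rewrite posE => /eqP[->]; exists t; left.
- by rewrite NegzE negE => /eqP[->]; exists t; right.
- by exists t.+1; rewrite posE.
by exists (- t.+1%:Z); rewrite negE.
Qed.

(** The pentagonal numbers in question are pairwise distinct, so no two terms of
    the series can cancel modulo two. *)
Lemma coef_pentagonal_mod2 N n : (0 < n < N)%N ->
  (pentagonal_sum 'X^8 N : {poly 'F_2})`_n != 0 <->
  exists t, n = (8 * (t.+1 ^ 2 + 'C(t.+1, 2)))%N \/
            n = (8 * (t.+1 ^ 2 + 'C(t.+2, 2)))%N.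
Proof.
case/andP=> n_gt0 ltnN; rewrite coefD coef1 gtn_eqF // add0r coef_sum.
have termE t : ((-1) ^+ t.+1 * ('X^8 ^+ (t.+1 ^ 2 + 'C(t.+1, 2)) +
      'X^8 ^+ (t.+1 ^ 2 + 'C(t.+2, 2))) : {poly 'F_2})`_n =
    (n == 8 * (t.+1 ^ 2 + 'C(t.+1, 2)))%N%:R +
    (n == 8 * (t.+1 ^ 2 + 'C(t.+2, 2)))%N%:R.
  have -> : -1 = 1 :> {poly 'F_2}.
    by rewrite -polyCN; congr polyC; apply/val_inj.
  by rewrite expr1n mul1r coefD -!exprM !coefXn.
under eq_bigr do rewrite termE.
split=> [|[t0 nt0]].
  have [/existsP[t /orP nt] _ | no_t] := boolP [exists t : 'I_N,
      (n == 8 * (t.+1 ^ 2 + 'C(t.+1, 2)))%N || (n == 8 * (t.+1 ^ 2 + 'C(t.+2, 2)))%N].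
    by exists t; case: nt => /eqP; [left | right].
  rewrite big1 ?eqxx // => t _; move: no_t; rewrite negb_exists => /forallP/(_ t).
  by rewrite negb_or => /andP[/negbTE-> /negbTE->]; rewrite addr0.
have lt0N : (t0 < N)%N by apply: leq_trans ltnN; case: nt0 => ->; nia.
rewrite (bigD1 (Ordinal lt0N)) //= big1 ?addr0 => [|t /negbTE].
  case: nt0 => nt0; rewrite nt0 eqxx eqn_pmul2l // eqn_add2l ?bin2S.
    by rewrite -{1}['C(_, 2)]addn0 eqn_add2l.
  by rewrite -{2}['C(_, 2)]addn0 eqn_add2l.
rewrite -val_eqE /= => /eqP ne_t.
have pent_lt u v : (u < v)%N ->
    (u.+1 ^ 2 + 'C(u.+2, 2) < v.+1 ^ 2 + 'C(v.+1, 2))%N.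
  by move=> ltuv; rewrite -addSn leq_add ?leq_bin2l // ltn_exp2r.
rewrite bin2S in nt0 *; case: (ltngtP t t0) ne_t => // /pent_lt lt_pent _.
  by rewrite !gtn_eqF ?addr0 //; move: lt_pent; rewrite !bin2S; case: nt0; lia.
by rewrite !ltn_eqF ?addr0 //; move: lt_pent; rewrite !bin2S; case: nt0; lia.
Qed.

(** * Counting the partitions *)

(** A partition in the class with k even parts consists of 2, 4, .., 2k, each
    once, and of odd parts at most 2k+1 with arbitrary multiplicities: the two
    blocks defined here. *)
Definition first_evens k := [seq i.*2.+2 | i <- iota 0 k].

Definition odd_block k (f : nat -> nat) :=
  flatten [seq nseq (f j) j.*2.+1 | j <- iota 0 k.+1].

Lemma double_succ_inj : injective (fun i => i.*2.+2).
Proof. by move=> i j /eqP; rewrite !eqSS => /eqP/double_inj. Qed.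

Lemma mem_first_evens k m : (m \in first_evens k) = [&& 0 < m, ~~ odd m & m <= k.*2]%N.
Proof.
apply/mapP/and3P => [[i] | [m_gt0 even_m le_m]].
  by rewrite mem_iota => /andP[_ lti] ->; rewrite /= odd_double; split=> //; lia.
exists m./2.-1; first by rewrite mem_iota; lia.
lia.
Qed.

Lemma count_odd_block k f a :
  count a (odd_block k f) = (\sum_(j < k.+1) a j.*2.+1 * f j)%N.
Proof.
rewrite /odd_block count_flatten -map_comp sumnE big_map -{1}[k.+1]subn0.
rewrite -/(index_iota 0 k.+1) big_mkord.
by apply: eq_bigr => j _; rewrite /= count_nseq.
Qed.

Lemma count_mem_odd_block k f j : (j <= k)%N ->
  count_mem j.*2.+1 (odd_block k f) = f j.
Proof.
move=> lejk; rewrite count_odd_block (bigD1 (Ordinal (lejk : j < k.+1)%N)) //=.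
rewrite eqxx mul1n big1 ?addn0 // => i; rewrite -val_eqE /= => /negbTE ne_ij.
by rewrite eqSS (inj_eq double_inj) ne_ij.
Qed.

Lemma odd_odd_block k f : all odd (odd_block k f).
Proof.
apply/allP=> m /flattenP[s /mapP[j _ ->]]; rewrite mem_nseq => /andP[_ /eqP->].
by rewrite /= odd_double.
Qed.

Lemma odd_block_le k f m : m \in odd_block k f -> (m <= k.*2.+1)%N.
Proof.
case/flattenP=> s /mapP[j]; rewrite mem_iota => /andP[_ ltj] ->.
by rewrite mem_nseq => /andP[_ /eqP->]; lia.
Qed.

Lemma sumn_first_evens k : sumn (first_evens k) = (k * k.+1)%N.
Proof.
rewrite sumnE big_map -{1}[k]subn0 -/(index_iota 0 k) big_mkord.
elim: k => [|k IHk]; first by rewrite big_ord0.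
by rewrite big_ord_recr /= IHk; lia.
Qed.

Lemma sumn_odd_block k f : sumn (odd_block k f) = (\sum_(j < k.+1) j.*2.+1 * f j)%N.
Proof.
rewrite /odd_block sumn_flatten -map_comp sumnE big_map -{1}[k.+1]subn0.
rewrite -/(index_iota 0 k.+1) big_mkord.
by apply: eq_bigr => j _; rewrite /= sumn_nseq.
Qed.

(** The conditions on a partition that depend only on the multiset of its parts,
    so that they pass through sorting. *)
Definition nu_shape (s : seq nat) : bool :=
  [&& all (ltn 0) s, even_parts_distinct s & smaller_evens_occur s].

Lemma nu_shape_perm (s t : seq nat) : perm_eq s t -> nu_shape s = nu_shape t.
Proof.
move=> st; rewrite /nu_shape (perm_all _ st) /even_parts_distinct.
rewrite (perm_uniq (perm_filter _ st)) /smaller_evens_occur (perm_all _ st).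
congr [&& _, _ & _]; apply: eq_all => m; apply: eq_forallb => e.
by rewrite (perm_mem st).
Qed.

Lemma nu_shape_blocks k f : nu_shape (first_evens k ++ odd_block k f).
Proof.
apply/and3P; split.
- rewrite all_cat; apply/andP; split; apply/allP => m.
    by rewrite mem_first_evens => /and3P[].
  by move/(allP (odd_odd_block k f)); case: m.
- rewrite /even_parts_distinct filter_cat.
  have -> : [seq m <- odd_block k f | ~~ odd m] = [::].
    by apply/eqP; rewrite -[_ == _]negbK -has_filter has_predC odd_odd_block.
  rewrite cats0 filter_uniq // map_inj_uniq ?iota_uniq //.
  exact: double_succ_inj.
apply/allP=> m; rewrite mem_cat => m_s; apply/forallP=> e; apply/implyP.
case/andP=> e_gt0 even_e; rewrite mem_cat mem_first_evens e_gt0 even_e /=.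
apply/orP; left; have lt_em := ltn_ord e.
case/orP: m_s; last by move/odd_block_le; lia.
by rewrite mem_first_evens; lia.
Qed.

Lemma count_even_blocks k f :
  count (predC odd) (first_evens k ++ odd_block k f) = k.
Proof.
rewrite count_cat [X in (_ + X)%N](_ : _ = 0%N) ?addn0; last first.
  apply/eqP; rewrite -leqn0 leqNgt -has_count -all_predC.
  by apply: sub_all (odd_odd_block k f) => m /= ->.
rewrite (eq_in_count (a2 := predT)) ?count_predT ?size_map ?size_iota //.
by move=> m; rewrite mem_first_evens => /and3P[].
Qed.

(** If m is a part and 2t <= m, then 2, .., 2t are all parts. So t is at most the
    number k of even parts: the k even parts are 2, .., 2k, and an odd part
    2t+1 has t <= k. *)
Lemma nu_shape_blocks_perm s : nu_shape s ->
  perm_eq s (first_evens (count (predC odd) s) ++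
             odd_block (count (predC odd) s) (fun j => count_mem j.*2.+1 s)).
Proof.
case/and3P=> pos_s uniq_ev closed_s; set k := count _ s.
pose ev := filter (predC odd) s.
have size_ev : size ev = k by rewrite size_filter.
have sub_ev t m : m \in s -> (t.*2 <= m)%N -> {subset first_evens t <= ev}.
  move=> m_s le_tm e; rewrite mem_first_evens => /and3P[e_gt0 even_e le_et].
  rewrite mem_filter /= even_e /=; case: (ltngtP e m) => [lt_em | | ->] //; last lia.
  have /forallP/(_ (Ordinal lt_em)) := allP closed_s _ m_s.
  by rewrite /= e_gt0 even_e.
have le_k t m : m \in s -> (t.*2 <= m)%N -> (t <= k)%N.
  move=> m_s le_tm; rewrite -size_ev -[t](size_iota 0) -(size_map (fun i => i.*2.+2)).
  apply: uniq_leq_size (sub_ev t m m_s le_tm).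
  by rewrite map_inj_uniq ?iota_uniq //; exact: double_succ_inj.
have ev_sub : {subset ev <= first_evens k}.
  move=> m; rewrite mem_filter => /andP[/= even_m m_s]; rewrite mem_first_evens.
  have m_gt0 : (0 < m)%N := allP pos_s _ m_s.
  by rewrite m_gt0 even_m /=; have := le_k m./2 m m_s; lia.
have perm_ev : perm_eq ev (first_evens k).
  apply: uniq_perm => //.
    by rewrite map_inj_uniq ?iota_uniq //; exact: double_succ_inj.
  have := uniq_min_size uniq_ev ev_sub; rewrite size_map size_iota.
  by rewrite -[X in size X]/ev size_ev => /(_ (leqnn _)) [].
rewrite -(permPl (permEl (perm_filterC (predC odd) s))) perm_cat //.
apply/allP => m _ /=; apply/eqP; rewrite count_filter.
have [odd_m | even_m] := boolP (odd m); last first.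
  transitivity 0%N.
    apply/eqP; rewrite -leqn0 leqNgt -has_count; apply/hasPn=> x _ /=.
    by case: eqP => // ->; rewrite even_m.
  apply/esym/count_memPn; apply: contra even_m.
  exact: (allP (odd_odd_block _ _)).
have -> : count (predI (pred1 m) (predC (predC odd))) s = count_mem m s.
  by apply: eq_count => x /=; case: eqP => // ->; rewrite odd_m.
have defm : m = m./2.*2.+1 by lia.
have [le_mk | lt_km] := leqP m./2 k; first by rewrite defm count_mem_odd_block // -defm.
rewrite (count_memPn _) ?(count_memPn _) //.
  by apply/negP => /odd_block_le; lia.
by apply/negP => /(le_k m./2); lia.
Qed.

Definition odd_mults n k : {set {ffun 'I_k.+1 -> 'I_n.+1}} :=
  [set f : {ffun 'I_k.+1 -> 'I_n.+1} |
    (k * k.+1 + \sum_(j < k.+1) j.*2.+1 * f j == n)%N].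

Lemma in_A_nu n p :
  (p \in A_nu n) = [&& sorted geq (parts p), nu_shape (parts p) & sumn (parts p) == n].
Proof.
rewrite inE /is_partition /nu_shape -!andbA.
by do !bool_congr; rewrite andbC andbA.
Qed.

Lemma geq_sorted_perm_eq (s t : seq nat) :
  sorted geq s -> sorted geq t -> perm_eq s t -> s = t.
Proof.
apply: sorted_eq => [y x z|x y]; first by move=> /= yx zy; exact: leq_trans zy yx.
by rewrite /geq /= => /andP[le1 le2]; apply/eqP; rewrite eqn_leq le1 le2.
Qed.

(** A partition is recovered from the multiplicities of its odd parts by sorting
    the two blocks. *)
Lemma card_A_nu_even_parts n k :
  #|[set p in A_nu n | count (predC odd) (parts p) == k]| = #|odd_mults n k|.
Proof.
pose mults (p : n.-bseq 'I_n.+1) : {ffun 'I_k.+1 -> 'I_n.+1} :=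
  [ffun j : 'I_k.+1 => inord (count_mem j.*2.+1 (parts p))].
have multsE p j : mults p j = count_mem j.*2.+1 (parts p) :> nat.
  rewrite ffunE inordK // ltnS (leq_trans (count_size _ _)) // size_map.
  exact: size_bseq.
set B := [set p in A_nu n | _].
have decomp p : p \in B ->
    perm_eq (parts p)
      (first_evens k ++ odd_block k (fun j => count_mem j.*2.+1 (parts p))).
  rewrite inE in_A_nu => /andP[/and3P[_ shape_p _] /eqP <-].
  exact: nu_shape_blocks_perm.
have mults_inj : {in B &, injective mults}.
  move=> p1 p2 B1 B2 eq12; apply: parts_inj; apply: geq_sorted_perm_eq.
  - by move: B1; rewrite inE in_A_nu => /andP[/andP[]].
  - by move: B2; rewrite inE in_A_nu => /andP[/andP[]].
  rewrite (permPl (decomp p1 B1)) perm_sym (permPl (decomp p2 B2)).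
  have -> // : odd_block k (fun j => count_mem j.*2.+1 (parts p2)) =
               odd_block k (fun j => count_mem j.*2.+1 (parts p1)).
  congr flatten; apply/eq_in_map => j; rewrite mem_iota => /andP[_ ltj].
  by have := congr1 (fun f : {ffun _ -> _} => val (f (Ordinal ltj))) eq12;
    rewrite /= !multsE /= => ->.
rewrite -(card_in_imset mults_inj); congr #|pred_of_set _|; apply/setP=> f.
rewrite [RHS]inE; apply/imsetP/eqP => [[p Bp ->] | sum_f].
  under eq_bigr do rewrite multsE.
  have := Bp; rewrite inE in_A_nu => /andP[/and3P[_ _ /eqP sum_p] _].
  rewrite -[RHS]sum_p (perm_sumn (decomp p Bp)) sumn_cat sumn_first_evens.
  by rewrite sumn_odd_block.
pose t := first_evens k ++ odd_block k (fun j => f (inord j)).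
have st : perm_eq (sort geq t) t by rewrite perm_sort.
have shape_t : nu_shape (sort geq t) by rewrite (nu_shape_perm st) nu_shape_blocks.
have sorted_t : sorted geq (sort geq t).
  by apply: sort_sorted => x y; rewrite /geq /= leq_total.
have sum_t : sumn (sort geq t) = n.
  rewrite (perm_sumn st) sumn_cat sumn_first_evens sumn_odd_block -[RHS]sum_f.
  by congr addn; apply: eq_bigr => j _; rewrite inord_val.
have [p pt] : exists p : n.-bseq 'I_n.+1, parts p = sort geq t.
  apply: is_partition_bseq; rewrite /is_partition sorted_t sum_t eqxx andbT.
  by case/and3P: shape_t.
exists p.
  rewrite inE in_A_nu pt sorted_t shape_t sum_t eqxx /=.
  by rewrite (permP st) count_even_blocks.
apply/ffunP=> j; apply/val_inj; rewrite /= multsE pt (permP st) count_cat.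
rewrite count_mem_odd_block -1?ltnS // inord_val (count_memPn _) //.
by rewrite mem_first_evens /= odd_double.
Qed.

Lemma card_A_nu n : #|A_nu n| = (\sum_(k < n.+1) #|odd_mults n k|)%N.
Proof.
pose evens (p : n.-bseq 'I_n.+1) : 'I_n.+1 := inord (count (predC odd) (parts p)).
have evensE p : evens p = count (predC odd) (parts p) :> nat.
  rewrite inordK // ltnS (leq_trans (count_size _ _)) // size_map.
  exact: size_bseq.
rewrite -sum1_card (partition_big evens xpredT) //=; apply: eq_bigr => k _.
rewrite -card_A_nu_even_parts -sum1_card; apply: eq_bigl => p.
by rewrite [RHS]inE -val_eqE /= evensE.
Qed.

(** Expanding the product of the geometric sums chooses one multiplicity for each
    odd part size. Multiplicities up to n suffice for the coefficient of X^n. *)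
Lemma coef_nu_series n :
  (nu_series n.+1 ('X : {poly int}))`_n = #|A_nu n|%:Z.
Proof.
rewrite card_A_nu -natz natr_sum coef_sum.
apply: eq_bigr => k _; rewrite /geom bigA_distr_bigA /= mulr_sumr coef_sum.
rewrite -sum1_card natr_sum [RHS]big_mkcond /=.
apply: eq_bigr => f _; rewrite inE.
under eq_bigr do rewrite -exprM.
rewrite -(big_morph _ (exprD _) (expr0 _)) -exprD coefXn eq_sym.
by case: eqP.
Qed.

(** The number of odd parts of a partition of n has the parity of n, so all
    summands of c(n) have the parity of n - 1. *)
Lemma oddz_c n : oddz (c n) = ~~ odd n && ((#|A_nu n|%:Z)%:~R != 0 :> 'F_2).
Proof.
rewrite /oddz (dvdz_pcharf (pchar_Fp (isT : prime 2))).
have -> : (c n)%:~R = (n%:R - 1) * #|A_nu n|%:R :> 'F_2.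
  rewrite rmorph_sum /= mulrC -sumr_const mulr_suml; apply: eq_bigr => p.
  rewrite in_A_nu => /and3P[_ _ /eqP sum_p]; rewrite mul1r rmorphB rmorph1 /=.
  rewrite -pmulrn; congr (_ - 1); rewrite -[in RHS]sum_p F2_natr [RHS]F2_natr.
  congr _%:R; congr nat_of_bool; rewrite /ell_o.
  elim: (parts p) => //= m s IHs; rewrite !oddD IHs; by case: (odd m).
rewrite mulf_eq0 negb_or -pmulrn; congr (_ && _); rewrite F2_natr.
by case: (odd n); rewrite ?subrr ?eqxx.
Qed.

Local Close Scope ring_scope.

Theorem corollary4p4 (n : nat) (n_gt0 : 0 < n) :
  oddz (c n) <-> exists m : int, gen_pentagonal m /\ (n%:Z = 8 * m)%R.
Proof.
have n_bounds : (0 < n < n.+1)%N by rewrite n_gt0 ltnSn.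
rewrite oddz_c -coef_nu_series.
have pent_int m : (n%:Z = 8 * m)%R -> exists2 r : nat, m = r & n = 8 * r /\ 0 < r.
  by move=> nm; exists `|m|%N; lia.
split=> [/andP[even_n] | [m [pent_m /pent_int[r defm [nr r_gt0]]]]].
  rewrite nu_coef_mod2 // => /(coef_pentagonal_mod2 n_bounds)[t [nt|nt]].
    exists (t.+1 ^ 2 + 'C(t.+1, 2))%N; split; last lia.
    by apply/gen_pentagonalP; [lia | exists t; left].
  exists (t.+1 ^ 2 + 'C(t.+2, 2))%N; split; last lia.
  by apply/gen_pentagonalP; [lia | exists t; right].
have even_n : ~~ odd n by rewrite nr oddM.
rewrite even_n nu_coef_mod2 //; apply/(coef_pentagonal_mod2 n_bounds).
move: pent_m; rewrite defm => /(gen_pentagonalP r_gt0)[t rt].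
by exists t; rewrite nr; case: rt => ->; [left | right].
Qed.
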